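(* For each $S\in\mathbf{Hrs}$ and every $\mathcal{X}\subseteq\omega^\omega$: $\mathcal{X}$ is $\mathbf{\Sigma}^0_S$ if and only if $\mathcal{X}\preceq\mathcal{E}_S$, and $\mathcal{X}$ is $\mathbf{\Pi}^0_S$ if and only if $\mathcal{X}\preceq\mathcal{A}_S$.
   Context: Setting: intuitionistic mathematics (intuitionistic logic), assuming the Second Axiom of Countable Choice and induction over the inductively defined class $\mathbf{Hrs}$. Finite sequences of natural numbers are coded bijectively by natural numbers; $s\ast t$ is concatenation, $\langle\,\rangle$ the empty sequence, $\overline{\alpha}n=\langle\alpha(0),\dots,\alpha(n-1)\rangle$; $(m,n)$ is a fixed pairing bijection $\omega\times\omega\to\omega$. For $X\subseteq\omega$: $X\upharpoonright s=\{t\mid s\ast t\in X\}$; for $\alpha\in\omega^\omega$: $(\alpha\upharpoonright s)(t)=\alpha(s\ast t)$. $\mathbf{Hrs}$ is the least class of subsets of $\omega$ with $1^\ast:=\{\langle\,\rangle\}\in\mathbf{Hrs}$ and, for every sequence $S_0,S_1,\dots$ in $\mathbf{Hrs}$, $\{\langle\,\rangle\}\cup\bigcup_{m,n}\langle(m,n)\rangle\ast S_n\in\mathbf{Hrs}$. For $S\in\mathbf{Hrs}$ and $\beta\in\omega^\omega$: $\mathcal{G}^{1^\ast}_\beta=\{\alpha\mid\exists n[\beta(\overline{\alpha}n)\neq0]\}$, $\mathcal{F}^{1^\ast}_\beta=\{\alpha\mid\forall n[\beta(\overline{\alpha}n)=0]\}$, and for $S\neq1^\ast$: $\mathcal{G}^S_\beta=\bigcup_n\mathcal{F}^{S\upharpoonright\langle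 n\rangle}_{\beta\upharpoonright\langle n\rangle}$, $\mathcal{F}^S_\beta=\bigcap_n\mathcal{G}^{S\upharpoonright\langle n\rangle}_{\beta\upharpoonright\langle n\rangle}$. $\mathcal{X}$ is $\mathbf{\Sigma}^0_S$ iff $\exists\beta[\mathcal{X}=\mathcal{G}^S_\beta]$ and $\mathbf{\Pi}^0_S$ iff $\exists\beta[\mathcal{X}=\mathcal{F}^S_\beta]$. Leading sets: $\mathcal{E}_{1^\ast}=\{\alpha\mid\exists n[\alpha(\langle n\rangle)\neq0]\}$, $\mathcal{A}_{1^\ast}=\{\alpha\mid\forall n[\alpha(\langle n\rangle)=0]\}$, and for $S\neq1^\ast$: $\mathcal{E}_S=\{\alpha\mid\exists n[\alpha\upharpoonright\langle n\rangle\in\mathcal{A}_{S\upharpoonright\langle n\rangle}]\}$, $\mathcal{A}_S=\{\alpha\mid\forall n[\alpha\upharpoonright\langle n\rangle\in\mathcal{E}_{S\upharpoonright\langle n\rangle}]\}$. Functions $\varphi:\omega^\omega\to\omega^\omega$ are continuous functions given by a code in $\omega^\omega$ which determines each value $(\varphi|\alpha)(n)$ from a finite initial segment of $\alpha$. $\mathcal{X}\preceq\mathcal{Y}$ iff there is $\varphi:\omega^\omega\to\omega^\omega$ with $\forall\alpha[\alpha\in\mathcal{X}\leftrightarrow\varphi|\alpha\in\mathcal{Y}]$. *)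

(* Defs.v *)
From mathcomp Require Import all_boot.
From Stdlib Require Cantor.

Set Implicit Arguments.
Unset Strict Implicit.
Unset Printing Implicit Defensive.

(* Everything is kept axiom-free: subsets are Prop-valued predicates, compared
   extensionally, and the one choice principle used is the explicit proposition
   [second_countable_choice]. *)

Definition baire := nat -> nat.

Definition eqset (T : Type) (X Y : T -> Prop) : Prop := forall x, X x <-> Y x.

(* [CodeSeq.code : seq nat -> nat] is a bijection with inverse
   [CodeSeq.decode] (lemmas [CodeSeq.codeK] and [CodeSeq.decodeK]). *)
Definition empty_seq : nat := CodeSeq.code [::].

Definition single (n : nat) : nat := CodeSeq.code [:: n].

Definition concat (s t : nat) : nat :=
  CodeSeq.code (CodeSeq.decode s ++ CodeSeq.decode t).

Definition initial (alpha : baire) (n : nat) : nat :=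
  CodeSeq.code (mkseq alpha n).

(* Used both for X|s with X a subset of omega (T := Prop) and for alpha|s with
   alpha in Baire space (T := nat). *)
Definition restr (T : Type) (f : nat -> T) (s : nat) : nat -> T :=
  fun t => f (concat s t).

(* [Cantor.to_nat] is a bijection with inverse [Cantor.of_nat]. *)
Definition pairing (m n : nat) : nat := Cantor.to_nat (m, n).

Definition one_star : nat -> Prop := fun s => s = empty_seq.

Definition hrs_join (T : nat -> nat -> Prop) : nat -> Prop :=
  fun s => s = empty_seq \/
    exists m n t, T n t /\ s = concat (single (pairing m n)) t.

(* The extensional equalities make membership in Hrs invariant under equality
   of subsets of omega. *)
Inductive Hrs : (nat -> Prop) -> Prop :=
| Hrs_one S : eqset S one_star -> Hrs S
| Hrs_join S (T : nat -> nat -> Prop) :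
    (forall n, Hrs (T n)) -> eqset S (hrs_join T) -> Hrs S.

(* The recursion over S in Hrs defining G^S_beta and F^S_beta is rendered by
   mutually inductive predicates; [calG_one], [calG_step], [calF_one] and
   [calF_step] below are the defining equations. *)
Inductive calG : (nat -> Prop) -> baire -> baire -> Prop :=
| calG_one_intro S beta alpha :
    eqset S one_star -> (exists n, beta (initial alpha n) <> 0) ->
    calG S beta alpha
| calG_step_intro S beta alpha n :
    ~ eqset S one_star ->
    calF (restr S (single n)) (restr beta (single n)) alpha ->
    calG S beta alpha
with calF : (nat -> Prop) -> baire -> baire -> Prop :=
| calF_one_intro S beta alpha :
    eqset S one_star -> (forall n, beta (initial alpha n) = 0) ->
    calF S beta alpha
| calF_step_intro S beta alpha :
    ~ eqset S one_star ->
    (forall n, calG (restr S (single n)) (restr beta (single n)) alpha) ->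
    calF S beta alpha.

Lemma calG_one S beta alpha : eqset S one_star ->
  calG S beta alpha <-> exists n, beta (initial alpha n) <> 0.
Proof.
move=> S1; split=> [H|]; last exact: calG_one_intro.
by case: H S1 => // S' b a n nS _ /nS.
Qed.

Lemma calG_step S beta alpha : ~ eqset S one_star ->
  calG S beta alpha <->
  exists n, calF (restr S (single n)) (restr beta (single n)) alpha.
Proof.
move=> nS1; split=> [H|[n Fn]]; last exact: calG_step_intro nS1 Fn.
by case: H nS1 => [S' b a S1 _ /(_ S1)|S' b a n _ Fn _] //; exists n.
Qed.

Lemma calF_one S beta alpha : eqset S one_star ->
  calF S beta alpha <-> forall n, beta (initial alpha n) = 0.
Proof.
move=> S1; split=> [H|]; last exact: calF_one_intro.
by case: H S1 => // S' b a nS _ /nS.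
Qed.

Lemma calF_step S beta alpha : ~ eqset S one_star ->
  calF S beta alpha <->
  forall n, calG (restr S (single n)) (restr beta (single n)) alpha.
Proof.
move=> nS1; split=> [H|]; last exact: calF_step_intro.
by case: H nS1 => // S' b a S1 _ /(_ S1).
Qed.

Definition Sigma0 (S : nat -> Prop) (X : baire -> Prop) : Prop :=
  exists beta, eqset X (calG S beta).

Definition Pi0 (S : nat -> Prop) (X : baire -> Prop) : Prop :=
  exists beta, eqset X (calF S beta).

(* Same rendering of recursion over Hrs as for [calG] and [calF]. *)
Inductive leadE : (nat -> Prop) -> baire -> Prop :=
| leadE_one_intro S alpha :
    eqset S one_star -> (exists n, alpha (single n) <> 0) -> leadE S alpha
| leadE_step_intro S alpha n :
    ~ eqset S one_star ->
    leadA (restr S (single n)) (restr alpha (single n)) -> leadE S alpha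
with leadA : (nat -> Prop) -> baire -> Prop :=
| leadA_one_intro S alpha :
    eqset S one_star -> (forall n, alpha (single n) = 0) -> leadA S alpha
| leadA_step_intro S alpha :
    ~ eqset S one_star ->
    (forall n, leadE (restr S (single n)) (restr alpha (single n))) ->
    leadA S alpha.

Lemma leadE_one S alpha : eqset S one_star ->
  leadE S alpha <-> exists n, alpha (single n) <> 0.
Proof.
move=> S1; split=> [H|]; last exact: leadE_one_intro.
by case: H S1 => // S' a n nS _ /nS.
Qed.

Lemma leadE_step S alpha : ~ eqset S one_star ->
  leadE S alpha <->
  exists n, leadA (restr S (single n)) (restr alpha (single n)).
Proof.
move=> nS1; split=> [H|[n An]]; last exact: leadE_step_intro nS1 An.
by case: H nS1 => [S' a S1 _ /(_ S1)|S' a n _ An _] //; exists n.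
Qed.

Lemma leadA_one S alpha : eqset S one_star ->
  leadA S alpha <-> forall n, alpha (single n) = 0.
Proof.
move=> S1; split=> [H|]; last exact: leadA_one_intro.
by case: H S1 => // S' a nS _ /nS.
Qed.

Lemma leadA_step S alpha : ~ eqset S one_star ->
  leadA S alpha <->
  forall n, leadE (restr S (single n)) (restr alpha (single n)).
Proof.
move=> nS1; split=> [H|]; last exact: leadA_step_intro.
by case: H nS1 => // S' a S1 _ /(_ S1).
Qed.

(* phi codes a (total) continuous function on Baire space: for each alpha and n
   some initial segment of alpha receives a nonzero value from phi|<n>, and
   the value at the shortest such segment is (phi|alpha)(n) + 1. *)
Definition is_code (phi : baire) : Prop :=
  forall (alpha : baire) (n : nat),
    exists m, restr phi (single n) (initial alpha m) != 0.

Definition apply_code (phi : baire) (Hphi : is_code phi) (alpha : baire) :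
    baire :=
  fun n =>
    (restr phi (single n) (initial alpha (ex_minn (Hphi alpha n)))).-1.

Definition reducible (X Y : baire -> Prop) : Prop :=
  exists (phi : baire) (Hphi : is_code phi),
    forall alpha, X alpha <-> Y (apply_code Hphi alpha).

Definition second_countable_choice : Prop :=
  forall R : nat -> baire -> Prop,
    (forall n, exists alpha, R n alpha) ->
    exists f : nat -> baire, forall n, R n (f n).

(* Main.v *)
From mathcomp Require Import all_boot.
From Stdlib Require Cantor.
Require Import Defs.

Set Implicit Arguments.
Unset Strict Implicit.
Unset Printing Implicit Defensive.

(** At a node [s] where [S|s] is [1*], the leading sets read [gamma] at
    [s * <n>] and the sets G, F read [beta] at [s * initial alpha n].  Hence
    [alpha |-> (s * <n> |-> beta (s * initial alpha n))] reduces G^S_beta to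
    E_S and F^S_beta to A_S, for all S at once.  Conversely, if a continuous F
    is given, beta is built by recursion on S: at [1*], [beta (initial alpha m)]
    is nonzero once [m] bounds an [n] and a stage at which F is seen to take a
    nonzero value at [<n>]; at a join, choice collects the codes for the maps
    [alpha |-> (F alpha)|<n>]. *)

Lemma concatA : associative concat.
Proof. by move=> s t u; rewrite /concat !CodeSeq.codeK catA. Qed.

Lemma concat0s : left_id empty_seq concat.
Proof. by move=> s; rewrite /concat CodeSeq.codeK CodeSeq.decodeK. Qed.

Lemma concat_single k t :
  concat (single k) t = CodeSeq.code (k :: CodeSeq.decode t).
Proof. by rewrite /concat /single CodeSeq.codeK. Qed.

Lemma concat_single_inj k l s t :
  concat (single k) s = concat (single l) t -> k = l /\ s = t.
Proof.
rewrite !concat_single => /(can_inj CodeSeq.codeK)[->].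
by move/(can_inj CodeSeq.decodeK).
Qed.

Lemma concat_single_neq0 k t : concat (single k) t <> empty_seq.
Proof. by rewrite concat_single => /(can_inj CodeSeq.codeK). Qed.

Lemma Hrs_empty_seq S : Hrs S -> S empty_seq.
Proof. by case=> [S' ->|S' T _ ->] //; left. Qed.

Lemma restr_hrs_join T k n :
  eqset (restr (hrs_join T) (single (pairing k n))) (T n).
Proof.
move=> t; split=> [[/concat_single_neq0 //|[i [j [u [Tu]]]]]|Tt].
  case/concat_single_inj => E ->.
  by move: (Cantor.cancel_of_to (k, n)); rewrite -/(pairing k n) E
    Cantor.cancel_of_to => -[_ <-].
by right; exists k, n, t.
Qed.

Lemma eqset_trans (T : Type) (X Y Z : T -> Prop) :
  eqset X Y -> eqset Y Z -> eqset X Z.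
Proof. by move=> XY YZ x; rewrite XY. Qed.

Lemma Hrs_eqset S S' : eqset S' S -> Hrs S -> Hrs S'.
Proof.
move=> + HS; case: HS => [S0 S1|S0 T HT ST] S'S.
  exact: Hrs_one (eqset_trans S'S S1).
exact: Hrs_join HT (eqset_trans S'S ST).
Qed.

(** The recursions for G, F, E and A descend to [restr S (single p)], whereas [Hrs_join] supplies
    the [T n]. Every [p] is some [pairing k n], so the two families agree, but only extensionally;
    hence the induction proves [P] for all sets equal to [S]. *)
Lemma Hrs_restr_ind (P : (nat -> Prop) -> Prop) :
  (forall S, eqset S one_star -> P S) ->
  (forall S, ~ eqset S one_star -> (forall n, Hrs (restr S (single n))) ->
    (forall n, P (restr S (single n))) -> P S) ->
  forall S, Hrs S -> P S.
Proof.
move=> P1 PJ S HS.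
suff: forall S', eqset S' S -> P S' by apply.
elim: HS => {S} [S S1|S T HT IH ST] S' S'S.
  exact: P1 (eqset_trans S'S S1).
have {S'S} S'T := eqset_trans S'S ST.
have sub p : exists n, eqset (restr S' (single p)) (T n).
  case Ep: (Cantor.of_nat p) => [k n]; exists n.
  have -> : p = pairing k n by rewrite /pairing -Ep Cantor.cancel_to_of.
  by move=> t; rewrite -(restr_hrs_join T k n t); apply: S'T.
(* A join is never [1*]: it contains the one-term sequence [single (pairing 0 0)], because [T 0]
   contains the empty sequence. *)
apply: PJ => [S'1|p|p].
- have /S'T/S'1 : hrs_join T (concat (single (pairing 0 0)) empty_seq).
    by right; exists 0, 0, empty_seq; split=> //; apply: Hrs_empty_seq.
  exact: concat_single_neq0.
- by have [n E] := sub p; apply: Hrs_eqset E (HT n).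
- by have [n /IH] := sub p.
Qed.

Lemma exists_iff (T : Type) (P Q : T -> Prop) :
  (forall x, P x <-> Q x) -> (exists x, P x) <-> exists x, Q x.
Proof. by move=> PQ; split=> -[x /PQ]; exists x. Qed.

Lemma forall_iff (T : Type) (P Q : T -> Prop) :
  (forall x, P x <-> Q x) -> (forall x, P x) <-> forall x, Q x.
Proof. by move=> PQ; split=> H x; apply/PQ. Qed.

(** Equality on [nat] is decidable, so being zero everywhere is the negation of being nonzero
    somewhere, even intuitionistically. *)
Lemma all_eq0_iff (f g : nat -> nat) :
  ((exists n, f n <> 0) <-> exists n, g n <> 0) ->
  (forall n, f n = 0) <-> forall n, g n = 0.
Proof.
move=> fg; split=> f0 n; apply/eqP; apply: contraT => /eqP nz.
  by have /fg[k] : exists k, g k <> 0; [exists n | rewrite f0].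
by have /fg[k] : exists k, f k <> 0; [exists n | rewrite f0].
Qed.

Definition leaf_match (beta alpha gamma : baire) : Prop :=
  forall s n, gamma (concat s (single n)) = beta (concat s (initial alpha n)).

(** [leaf_match] is required at every [s], not only at the leaves of [S]; it therefore passes to the
    restrictions of [beta] and [gamma] to [single n], which is what the induction on [S] needs. *)
Lemma lead_leaf_match S beta alpha gamma :
  Hrs S -> leaf_match beta alpha gamma ->
  (calG S beta alpha <-> leadE S gamma) /\
  (calF S beta alpha <-> leadA S gamma).
Proof.
move=> HS; move: S HS beta gamma.
apply: Hrs_restr_ind => [S S1|S nS1 _ IH] beta gamma E.
  have E0 n : gamma (single n) = beta (initial alpha n).
    by have:= E empty_seq n; rewrite !concat0s.
  rewrite calG_one // leadE_one // calF_one // leadA_one //.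
  by split; [apply: exists_iff => n | apply: forall_iff => n]; rewrite E0.
have {}IH n := IH n (restr beta (single n)) (restr gamma (single n)).
have {}IH n : (calG (restr S (single n)) (restr beta (single n)) alpha <->
    leadE (restr S (single n)) (restr gamma (single n))) /\
  (calF (restr S (single n)) (restr beta (single n)) alpha <->
    leadA (restr S (single n)) (restr gamma (single n))).
  by apply: IH => s k; rewrite /restr !concatA E.
rewrite calG_step // leadE_step // calF_step // leadA_step //.
by split; [apply: exists_iff => n; case: (IH n)
  | apply: forall_iff => n; case: (IH n)].
Qed.

(* [t] is read as [s * <n>]; the junk value at the empty sequence is harmless. *)
Definition leaf_fun (beta alpha : baire) : baire := fun t =>
  let d := CodeSeq.decode t in
  beta (CodeSeq.code (take (size d).-1 d ++ mkseq alpha (last 0 d))).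

Lemma leaf_funP beta alpha : leaf_match beta alpha (leaf_fun beta alpha).
Proof.
move=> s n; rewrite /leaf_fun /concat !CodeSeq.codeK cats1 size_rcons /=.
by rewrite last_rcons -cats1 take_size_cat.
Qed.

(** Replaces function extensionality: both [beta] and [beta'] match the same [gamma], so both are
    compared with the same leading sets. *)
Lemma cal_eq_beta S beta beta' alpha : Hrs S -> beta =1 beta' ->
  (calG S beta alpha <-> calG S beta' alpha) /\
  (calF S beta alpha <-> calF S beta' alpha).
Proof.
move=> HS bb'; have E := @leaf_funP beta' alpha.
have E' : leaf_match beta alpha (leaf_fun beta' alpha).
  by move=> s n; rewrite bb' E.
have [-> ->] := lead_leaf_match HS E.
exact: lead_leaf_match.
Qed.

(** The word [w] is an argument [t] followed by a segment [u] of alpha. The answer uses only the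
    first [last 0 d] terms of [u], so all long enough segments give the same one. *)
Definition leaf_code (beta : baire) : baire := fun w =>
  if CodeSeq.decode w is t :: u then
    let d := CodeSeq.decode t in
    if last 0 d <= size u then
      (beta (CodeSeq.code (take (size d).-1 d ++ take (last 0 d) u))).+1
    else 0
  else 0.

Lemma leaf_codeE beta alpha t m :
  restr (leaf_code beta) (single t) (initial alpha m) =
  if last 0 (CodeSeq.decode t) <= m then (leaf_fun beta alpha t).+1 else 0.
Proof.
rewrite /restr /leaf_code concat_single !CodeSeq.codeK size_mkseq.
case: ifP => // le_m; rewrite /leaf_fun; congr (beta (CodeSeq.code (_ ++ _))).+1.
by rewrite /mkseq -map_take take_iota (minn_idPl le_m).
Qed.

Lemma leaf_code_is_code beta : is_code (leaf_code beta).
Proof.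
by move=> alpha t; exists (last 0 (CodeSeq.decode t)); rewrite leaf_codeE leqnn.
Qed.

Lemma apply_leaf_code beta alpha :
  apply_code (leaf_code_is_code beta) alpha =1 leaf_fun beta alpha.
Proof.
move=> t; rewrite /apply_code; case: ex_minnP => m; rewrite leaf_codeE.
by case: ifP.
Qed.

Lemma cal_reducible S beta : Hrs S ->
  reducible (calG S beta) (leadE S) /\ reducible (calF S beta) (leadA S).
Proof.
move=> HS; have E alpha :
    leaf_match beta alpha (apply_code (leaf_code_is_code beta) alpha).
  by move=> s n; rewrite apply_leaf_code leaf_funP.
by split; exists (leaf_code beta), (leaf_code_is_code beta) => alpha;
  case: (lead_leaf_match HS (E alpha)).
Qed.

(* The code is curried so that passing from F to [alpha |-> (F alpha)|<n>] is a
   mere relabelling of the first argument. *)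
Definition realizes (phi : nat -> nat -> nat) (F : baire -> baire) : Prop :=
  forall alpha n, exists m, phi n (initial alpha m) = (F alpha n).+1 /\
    forall k, k < m -> phi n (initial alpha k) = 0.

Lemma apply_code_realizes phi (Hphi : is_code phi) :
  realizes (fun n => restr phi (single n)) (apply_code Hphi).
Proof.
move=> alpha n; rewrite /apply_code; case: ex_minnP => m nz le_m.
exists m; split=> [|k lt_km]; first by rewrite prednK // lt0n.
by apply/eqP; apply: contraLR lt_km => /le_m; rewrite -leqNgt.
Qed.

(** Both searches are bounded by the length of [s], so the test is decidable. Codes carry values
    shifted by one, whence [1 <]; the last clause makes [m] the first stage with an answer. *)
Definition seen_nonzero (phi : nat -> nat -> nat) : baire := fun s =>
  let d := CodeSeq.decode s in
  let val n m := phi (single n) (CodeSeq.code (take m d)) in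
  [exists n : 'I_(size d).+1, [exists m : 'I_(size d).+1,
    (1 < val n m) && [forall k : 'I_m, val n k == 0]]].

Lemma seen_nonzeroP phi F alpha : realizes phi F ->
  (exists n, F alpha (single n) <> 0) <->
  exists l, seen_nonzero phi (initial alpha l) <> 0.
Proof.
have take_mk m l : m <= l -> take m (mkseq alpha l) = mkseq alpha m.
  by move=> le_ml; rewrite /mkseq -map_take take_iota (minn_idPl le_ml).
move=> phiF; split=> [[n nz]|[l]].
  have [m [Em lt_m]] := phiF alpha (single n).
  exists (maxn n m); apply/eqP; rewrite /seen_nonzero eqb0 negbK.
  rewrite /initial CodeSeq.codeK size_mkseq.
  have n_le : n < (maxn n m).+1 by rewrite ltnS leq_maxl.
  have m_le : m < (maxn n m).+1 by rewrite ltnS leq_maxr.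
  apply/existsP; exists (Ordinal n_le); apply/existsP; exists (Ordinal m_le).
  rewrite /= take_mk ?leq_maxr // -/(initial alpha m) Em ltnS lt0n.
  apply/andP; split; first exact/eqP.
  apply/forallP=> k; rewrite take_mk; first exact/eqP/lt_m.
  by rewrite (leq_trans (ltnW (ltn_ord k))) ?leq_maxr.
move/eqP; rewrite /seen_nonzero eqb0 negbK /initial CodeSeq.codeK size_mkseq.
case/existsP=> n /existsP[m /andP[gt1 /forallP eq0]]; exists n => Fn0.
have [m' [Em' lt_m']] := phiF alpha (single n).
have m_le : m <= l by rewrite -ltnS.
rewrite take_mk // -/(initial alpha m) in gt1.
(* Both [m] and [m'] are the first stage with an answer, so they coincide; the code there is 1,
   against [gt1]. *)
case: (ltngtP m m') => [lt|lt|E].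
- by rewrite lt_m' in gt1.
- have := eq0 (Ordinal lt); rewrite /= take_mk ?(leq_trans (ltnW lt)) //.
  by rewrite -/(initial alpha m') Em'.
- by rewrite E Em' Fn0 in gt1.
Qed.

Lemma realizes_cal (AC : second_countable_choice) S : Hrs S ->
  forall phi F, realizes phi F -> exists beta, forall alpha,
    (leadE S (F alpha) <-> calG S beta alpha) /\
    (leadA S (F alpha) <-> calF S beta alpha).
Proof.
move=> HS; move: S HS.
apply: Hrs_restr_ind => [S S1|S nS1 HS IH] phi F phiF.
  exists (seen_nonzero phi) => alpha.
  rewrite calG_one // leadE_one // calF_one // leadA_one //.
  have E := seen_nonzeroP alpha phiF.
  by split=> //; apply: all_eq0_iff.
have {phiF}IH n := IH n (fun k => phi (concat (single n) k))
  (fun alpha => restr (F alpha) (single n))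
  (fun alpha k => phiF alpha (concat (single n) k)).
have [b bP] := AC _ IH.
(* Glues the chosen codes under their first entries; the value at the empty sequence is never read,
   since [S] is not [1*]. *)
pose beta : baire := fun s =>
  if CodeSeq.decode s is n :: t then b n (CodeSeq.code t) else 0.
have beta_restr n : restr beta (single n) =1 b n.
  move=> t; rewrite /restr /beta concat_single CodeSeq.codeK.
  by rewrite CodeSeq.decodeK.
have {}bP n alpha :
    (leadE (restr S (single n)) (restr (F alpha) (single n)) <->
     calG (restr S (single n)) (restr beta (single n)) alpha) /\
    (leadA (restr S (single n)) (restr (F alpha) (single n)) <->
     calF (restr S (single n)) (restr beta (single n)) alpha).
  have [-> ->] := cal_eq_beta alpha (HS n) (beta_restr n).
  exact: bP.
exists beta => alpha.
rewrite calG_step // leadE_step // calF_step // leadA_step //.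
by split; [apply: exists_iff => n; case: (bP n alpha)
  | apply: forall_iff => n; case: (bP n alpha)].
Qed.

Lemma reducible_eqset X X' Y : eqset X X' -> reducible X' Y -> reducible X Y.
Proof.
by move=> XX' [phi [Hphi E]]; exists phi, Hphi => alpha; rewrite XX' E.
Qed.

Theorem theorem3p14
  (AC : second_countable_choice)
  (S : nat -> Prop) (HS : Hrs S)
  (X : baire -> Prop) :
  (Sigma0 S X <-> reducible X (leadE S)) /\
  (Pi0 S X <-> reducible X (leadA S)).
Proof.
split; split=> [[beta Xb]|[phi [Hphi E]]].
- exact: reducible_eqset Xb (cal_reducible beta HS).1.
- have [beta bP] := realizes_cal AC HS (apply_code_realizes Hphi).
  by exists beta => alpha; rewrite E (bP alpha).1.
- exact: reducible_eqset Xb (cal_reducible beta HS).2.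
- have [beta bP] := realizes_cal AC HS (apply_code_realizes Hphi).
  by exists beta => alpha; rewrite E (bP alpha).2.
Qed.
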